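(* For every $\ell\ge 3$ and every $n\ge \ell$, \(\widehat P^{(3)}(n,\ell)\subsetneq DI(n,\ell)\). When $n<\ell$, both ideals are the whole polynomial ring. Thus the strict containment holds precisely in the non-vacuous range.
   Context: Let $\mathbf{k}$ be a field of characteristic zero and $S_n=\mathbf{k}[x_1,\ldots,x_n]$. For a 3-graph $G$ with vertex set contained in $[n]$, define $p_G=\prod_{1\le i<j<k\le n,\ ijk\notin G}(x_i-x_j)(x_i-x_k)(x_j-x_k)$. Let $I(n,\ell)\subset S_n$ be the ideal of polynomials that vanish after the identification of any $\ell$ variables (i.e. on every diagonal $x_{i_1}=\cdots=x_{i_\ell}$). Define $DI(n,\ell)=\{p\in S_n: \partial^j p/\partial x_i^j\in I(n,\ell)$ for every $i\in[n]$ and every $0\le j\le n-3\}$. Let $\widehat P^{(3)}(n,\ell)$ be the ideal of $S_n$ generated by the polynomials $p_G$ with $G$ ranging over all $(\ell-1)$-partite 3-graphs with vertex set contained in $[n]$. *)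

(* Defs.v *)
From HB Require Import structures.
From mathcomp Require Export all_boot all_algebra.
From mathcomp.multinomials Require Export mpoly.

Set Implicit Arguments.
Unset Strict Implicit.
Unset Printing Implicit Defensive.

Import GRing.Theory.
Local Open Scope ring_scope.

(* The vertex set [n] = {1, ..., n} is rendered as 'I_n = {0, ..., n - 1}. *)
Record graph3 (n : nat) := Graph3 {
  vertices : {set 'I_n};
  edges : {set {set 'I_n}};
  edgesP : forall e : {set 'I_n},
    e \in edges -> (e \subset vertices) /\ #|e| = 3%N
}.

(* Parts may be empty, and an edge meets each part in at most one vertex. *)
Definition partite (n r : nat) (G : graph3 n) : Prop :=
  exists V : 'I_r -> {set 'I_n},
    [/\ \bigcup_(a < r) V a = vertices G,
        forall a b : 'I_r, a != b -> [disjoint V a & V b]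
      & forall (e : {set 'I_n}) (a : 'I_r),
          e \in edges G -> (#|e :&: V a| <= 1)%N].

Definition graph_poly (k : fieldType) (n : nat) (G : graph3 n) :
    {mpoly k[n]} :=
  \prod_(i < n) \prod_(j < n | (i < j)%N)
    \prod_(h < n | (j < h)%N && ([set i; j; h] \notin edges G))
      (('X_i - 'X_j) * ('X_i - 'X_h) * ('X_j - 'X_h)).

(* The substitution 'X_i := 'X_a for every i \in A. *)
Definition identify (k : fieldType) (n : nat) (A : {set 'I_n}) (a : 'I_n)
    (p : {mpoly k[n]}) : {mpoly k[n]} :=
  p \mPo [tuple (if i \in A then 'X_a else 'X_i) | i < n].

Definition diag_ideal (k : fieldType) (n l : nat) (p : {mpoly k[n]}) : Prop :=
  forall (A : {set 'I_n}) (a : 'I_n),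
    #|A| = l -> a \in A -> identify A a p = 0.

(* The bound j <= n - 3 is written j + 3 <= n, so that there is no condition
   when n < 3. *)
Definition deriv_ideal (k : fieldType) (n l : nat) (p : {mpoly k[n]}) : Prop :=
  forall (i : 'I_n) (j : nat), (j + 3 <= n)%N -> diag_ideal l p^`M(i, j).

Definition ideal_gen (R : comNzRingType) (S : R -> Prop) (p : R) : Prop :=
  exists s : seq (R * R),
    (forall cg, cg \in s -> S cg.2) /\ p = \sum_(cg <- s) cg.1 * cg.2.

Definition partite_ideal (k : fieldType) (n l : nat) : {mpoly k[n]} -> Prop :=
  ideal_gen (fun p : {mpoly k[n]} =>
    exists G : graph3 n, partite l.-1 G /\ p = graph_poly k G).

Definition strict_subset (T : Type) (P Q : T -> Prop) : Prop :=
  (forall x, P x -> Q x) /\ exists x, Q x /\ ~ P x.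

Arguments diag_ideal k n l p : clear implicits.
Arguments deriv_ideal k n l p : clear implicits.
Arguments partite_ideal k n l p : clear implicits.

(* Main.v *)
From HB Require Import structures.
Require Import Defs.
From mathcomp Require Import zify.
Set Implicit Arguments.
Unset Strict Implicit.
Unset Printing Implicit Defensive.
Import GRing.Theory.
Local Open Scope ring_scope.

(** Each difference of a triple is attributed to its pair of indices, so that
    [p_G] is the product over [i < j] of [(x_i - x_j) ^ d(i, j)], where
    [d(i, j)] counts the [h] such that [ijh] is not an edge.  An
    [(l - 1)]-colouring [c] of [G] makes [d(i, j) = n - 2] on monochromatic
    pairs, and any [l] vertices contain such a pair; hence every multiple of
    [p_G], and likewise the product [f_c] of [(x_i - x_j) ^ (n - 2)] over the
    monochromatic pairs, lies in [DI(n, l)].  For [n >= l] the degree of [p_G]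
    exceeds that of some [f_c']: some vertex differs in colour from a
    monochromatic pair and contributes extra factors, unless [c] is constant,
    in which case recolouring one vertex lowers the degree of [f_c].  So an
    [f_c] of least degree has smaller degree than every generator and is not
    in the ideal that they generate. *)

(** * From triples to pairs *)

Lemma prod_triples_by_pairs (R : comNzRingType) (n : nat) (P : pred {set 'I_n})
    (F : 'I_n -> 'I_n -> R) :
  \prod_(i < n) \prod_(j < n | (i < j)%N)
    \prod_(h < n | (j < h)%N && P [set i; j; h]) (F i j * F i h * F j h) =
  \prod_(i < n) \prod_(j < n | (i < j)%N)
    F i j ^+ #|[set h | [&& h != i, h != j & P [set i; j; h]]]|.
Proof.
pose T (c : 'I_n -> 'I_n -> 'I_n -> bool) :=
  \prod_(i < n) \prod_(j < n) \prod_(h < n)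
     if c i j h && P [set i; j; h] then F i j else 1.
(* The three factors collect, for a pair [i < j], the third vertices [h] above, between and below
   the pair. *)
have -> : \prod_(i < n) \prod_(j < n | (i < j)%N)
    \prod_(h < n | (j < h)%N && P [set i; j; h]) (F i j * F i h * F j h) =
  T (fun i j h => (i < j < h)%N) * T (fun i j h => (i < h < j)%N) *
  T (fun i j h => (h < i < j)%N).
  have -> : T (fun i j h => (i < h < j)%N) =
    \prod_(i < n) \prod_(j < n) \prod_(h < n)
      if (i < j < h)%N && P [set i; j; h] then F i h else 1.
    apply: eq_bigr => i _; rewrite exchange_big.
    by do 2![apply: eq_bigr => ? _]; rewrite setUAC.
  have -> : T (fun i j h => (h < i < j)%N) =
    \prod_(i < n) \prod_(j < n) \prod_(h < n)
      if (i < j < h)%N && P [set i; j; h] then F j h else 1.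
    rewrite /T [RHS]exchange_big; apply: eq_bigr => i _.
    rewrite [RHS]exchange_big; apply: eq_bigr => j _.
    by apply: eq_bigr => h _; rewrite [in LHS]setUC setUA.
  rewrite -!big_split; apply: eq_bigr => i _; rewrite -!big_split big_mkcond.
  apply: eq_bigr => j _; rewrite -!big_split.
  case: ltnP => /= _; last by rewrite big1 // => h _; rewrite !mul1r.
  by rewrite big_mkcond; apply: eq_bigr => h _; case: ifP; rewrite ?mul1r.
rewrite -!big_split; apply: eq_bigr => i _; rewrite -!big_split [RHS]big_mkcond.
apply: eq_bigr => j _; rewrite -!big_split -prodr_const [in RHS]big_mkcond.
case: ltnP => /= ltij.
  apply: eq_bigr => h _; rewrite inE andbA -!val_eqE /=.
  by case: (P _); rewrite ?andbF ?mul1r // !andbT;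
    case: (ltngtP h i); case: (ltngtP h j); rewrite /= ?mulr1 ?mul1r // => *;
    exfalso; lia.
by apply: big1 => h _; rewrite !andbF /= [(i < h < j)%N](_ : _ = false) ?mul1r //; lia.
Qed.


(** * Derivatives of multiples of a power *)

Lemma mderivXn (R : comNzRingType) (n : nat) (d : {mpoly R[n]}) (m : nat)
    (i : 'I_n) : (d ^+ m)^`M(i) = d^`M(i) * d ^+ m.-1 *+ m.
Proof.
elim: m => [|m IHm]; first by rewrite expr0 -mpolyC1 mderivC.
rewrite exprS mderivM IHm mulrSr addrC; congr (_ + _).
by case: m {IHm} => [|m]; rewrite ?mulr0 // mulrnAr mulrCA -exprS.
Qed.

(** By the Leibniz rule each derivative costs at most one factor [d]. *)
Lemma mderivn_multiple (R : comNzRingType) (n : nat) (q d : {mpoly R[n]})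
    (m : nat) (i : 'I_n) (j : nat) :
  exists q', (q * d ^+ m)^`M(i, j) = q' * d ^+ (m - j).
Proof.
elim: j => [|j [q' IHj]]; first by exists q; rewrite mderivn0 subn0.
rewrite mderivnS IHj mderivM mderivXn subnS.
(* Once the exponent has reached 0, truncated subtraction keeps it there, and no factor [d] has to
   be made up for. *)
exists (q'^`M(i) * (if (m - j)%N is 0%N then 1 else d) + q' * d^`M(i) *+ (m - j)).
rewrite mulrDl mulrnAr mulrA mulrnAl; congr (_ + _).
by case: (m - j)%N => [|s]; rewrite ?mulr1 // -mulrA -exprS.
Qed.

Lemma deriv_ideal_multiple (k : fieldType) (n l : nat) (p : {mpoly k[n]}) :
  (forall A : {set 'I_n}, #|A| = l ->
     exists a b, [/\ a \in A, b \in A &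
       exists q, p = q * ('X_a - 'X_b) ^+ (n - 2)]) ->
  deriv_ideal k n l p.
Proof.
move=> pP i j lej A c cardA Ac; have [a [b [Aa Ab [q ->]]]] := pP A cardA.
have [q' ->] := mderivn_multiple q ('X_a - 'X_b) (n - 2) i j.
(* Since [j] is at most [n - 3], at least one factor ['X_a - 'X_b] survives, and the identification
   kills it. *)
have -> : (n - 2 - j = (n - 2 - j).-1.+1)%N by lia.
rewrite /identify rmorphM rmorphXn rmorphB /= !comp_mpolyXU -!tnth_nth !tnth_mktuple.
by rewrite Aa Ab subrr expr0n mulr0.
Qed.

Lemma deriv_ideal_sum (k : fieldType) (n l : nat) (I : eqType) (s : seq I)
    (F : I -> {mpoly k[n]}) :
  (forall x, x \in s -> deriv_ideal k n l (F x)) ->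
  deriv_ideal k n l (\sum_(x <- s) F x).
Proof.
move=> FP i j lej A a cardA Aa; rewrite /identify !raddf_sum big_seq big1 //.
by move=> x xs; apply: FP.
Qed.

Lemma pigeonhole_ord (n r : nat) (c : 'I_n -> 'I_r) (A : {set 'I_n}) :
  (r < #|A|)%N ->
  exists a b : 'I_n, [/\ a \in A, b \in A, (a < b)%N & c a = c b].
Proof.
move=> ltrA; have : ~~ dinjectiveb c A.
  apply/negP => /dinjectiveP injc.
  by have := max_card (mem (c @: A)); rewrite card_in_imset // card_ord leqNgt ltrA.
case/dinjectivePn => a Aa [b /andP[neqba Ab] eqc].
by case: (ltngtP a b) => [||/val_inj] ab; [exists a, b | exists b, a |
  rewrite ab eqxx in neqba].
Qed.

(** * Pair polynomials and colourings *)

Definition pair_poly (k : fieldType) (n : nat) (e : 'I_n -> 'I_n -> nat) :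
    {mpoly k[n]} :=
  \prod_(i < n) \prod_(j < n | (i < j)%N) ('X_i - 'X_j) ^+ e i j.

Definition pair_weight (n : nat) (e : 'I_n -> 'I_n -> nat) : nat :=
  (\sum_(i < n) \sum_(j < n | i < j) e i j)%N.

Definition codegree (n : nat) (G : graph3 n) (i j : 'I_n) : nat :=
  #|[set h | [&& h != i, h != j & [set i; j; h] \notin edges G]]|.

(** The exponents of [f_c]. For [n >= 3], [n - 2] is one more than the largest order of derivative
    in [deriv_ideal]. *)
Definition monochromatic_exp (n r : nat) (c : 'I_n -> 'I_r) (i j : 'I_n) : nat :=
  if c i == c j then (n - 2)%N else 0%N.

Lemma graph_polyE (k : fieldType) (n : nat) (G : graph3 n) :
  graph_poly k G = pair_poly k (codegree G).
Proof.
exact: (prod_triples_by_pairs (fun e => e \notin edges G)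
  (fun i j => 'X_i - 'X_j : {mpoly k[n]})).
Qed.

(** The multiplier [q] lets one statement serve both the multiples of [p_G] and, with [q = 1], [f_c]
    itself. *)
Lemma pair_poly_deriv_ideal (k : fieldType) (n r l : nat) (c : 'I_n -> 'I_r)
    (e : 'I_n -> 'I_n -> nat) (q : {mpoly k[n]}) :
  (r < l)%N ->
  (forall i j, i != j -> (monochromatic_exp c i j <= e i j)%N) ->
  deriv_ideal k n l (q * pair_poly k e).
Proof.
move=> ltrl ge_e; apply: deriv_ideal_multiple => A cardA.
have [|a [b [Aa Ab ltab eqc]]] := @pigeonhole_ord n r c A; first by rewrite cardA.
exists a, b; split=> //.
have neqab : a != b by rewrite -val_eqE /= ltn_eqF.
have := ge_e a b neqab; rewrite /monochromatic_exp eqc eqxx => le_e.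
rewrite /pair_poly (bigD1 a) //= (bigD1 b) //= -(subnK le_e) exprD.
rewrite -!mulrA [_ ^+ (n - 2) * _]mulrC !mulrA; eexists; reflexivity.
Qed.

Lemma partite_coloring (n r : nat) (G : graph3 n) :
  partite r.+1 G ->
  exists c : {ffun 'I_n -> 'I_r.+1}, forall i j h : 'I_n,
    i != j -> c i = c j -> [set i; j; h] \notin edges G.
Proof.
case=> V [coverV _ edgeV].
(* A vertex in no part gets the default colour; this is harmless, as it lies in no edge. *)
exists [ffun i => odflt ord0 [pick a | i \in V a]] => i j h neqij.
rewrite !ffunE => eqc; apply/negP => Ge.
have inV x : x \in [set i; j; h] -> x \in V (odflt ord0 [pick a | x \in V a]).
  move=> ex; case: pickP => //= noV.
  have /bigcupP[a _] : x \in \bigcup_(a < r.+1) V a.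
    by rewrite coverV; have [/subsetP -> //] := edgesP Ge.
  by have /= -> := noV a.
have := edgeV _ (odflt ord0 [pick a | i \in V a]) Ge; apply/negP; rewrite -ltnNge.
have <- : #|[set i; j]| = 2%N by rewrite cards2 neqij.
have ei : i \in [set i; j; h] by rewrite !inE eqxx.
have ej : j \in [set i; j; h] by rewrite !inE eqxx orbT.
apply/subset_leq_card/subsetP => x /set2P[] ->; rewrite in_setI.
  by rewrite ei inV.
by rewrite ej eqc inV.
Qed.

Lemma monochromatic_exp_le_codegree (n r : nat) (G : graph3 n)
    (c : 'I_n -> 'I_r) :
  (forall i j h, i != j -> c i = c j -> [set i; j; h] \notin edges G) ->
  forall i j, i != j -> (monochromatic_exp c i j <= codegree G i j)%N.
Proof.
move=> cP i j neqij; rewrite /monochromatic_exp; case: eqP => // eqc.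
have -> : (n - 2 = #|~: [set i; j]|)%N.
  by have := cardsC [set i; j]; rewrite cards2 neqij card_ord; lia.
apply/subset_leq_card/subsetP => h; rewrite !inE negb_or => /andP[-> ->] /=.
exact: cP.
Qed.

(** * Comparison of weights *)

Lemma pair_weight_lt (n : nat) (e e' : 'I_n -> 'I_n -> nat) (a b : 'I_n) :
  (forall i j, i != j -> (e i j <= e' i j)%N) ->
  (a < b)%N -> (e a b < e' a b)%N -> (pair_weight e < pair_weight e')%N.
Proof.
move=> le_e ltab lt_e; rewrite /pair_weight !pair_big_dep /=.
rewrite (bigD1 (a, b)) //= [X in (_ < X)%N](bigD1 (a, b)) //= -addSn leq_add //.
by apply: leq_sum => -[i j] /= /andP[ltij _]; apply: le_e; rewrite -val_eqE /= ltn_eqF.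
Qed.

Lemma exists_lighter_coloring (n r : nat) (G : graph3 n) :
  partite r.+2 G -> (r.+2 < n)%N ->
  exists c : {ffun 'I_n -> 'I_r.+2},
    (pair_weight (monochromatic_exp c) < pair_weight (codegree G))%N.
Proof.
move=> /partite_coloring[c cP] ltrn; have le_e := monochromatic_exp_le_codegree cP.
have [|u [v [_ _ ltuv eqc]]] := @pigeonhole_ord n r.+2 c setT.
  by rewrite cardsT card_ord.
(* If [w] has another colour than [u] and [v], then [f_c] has exponent 0 on the pair of [u] and [w],
   whereas the non-edge [uvw] makes its codegree positive. *)
case: (pickP [pred w | c w != c u]) => [w /= neqcw | constc].
  have neqwu : w != u by apply: contraNneq neqcw => ->.
  have neqwv : w != v by apply: contraNneq neqcw => ->; rewrite eqc.
  have nequv : u != v by rewrite -val_eqE /= ltn_eqF.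
  exists c; case: (ltngtP u w) => [lt | lt | /val_inj eq]; last by rewrite eq eqxx in neqwu.
    apply: (pair_weight_lt le_e lt); rewrite /monochromatic_exp eq_sym (negPf neqcw).
    rewrite card_gt0; apply/set0Pn; exists v.
    by rewrite inE eq_sym nequv eq_sym neqwv setUAC cP.
  apply: (pair_weight_lt le_e lt); rewrite /monochromatic_exp (negPf neqcw).
  rewrite card_gt0; apply/set0Pn; exists v.
  by rewrite inE eq_sym neqwv eq_sym nequv -setUA setUC cP.
have n0 : (0 < n)%N by lia.
have n1 : (1 < n)%N by lia.
(* Here [c] is constant and all codegrees are at least [n - 2 > 0]. Giving vertex 0 a colour of its
   own lowers the exponent of the pair of 0 and 1 to 0. *)
exists [ffun i => if i == Ordinal n0 then ord0 else lift ord0 ord0].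
have eqcc i j : c i = c j.
  by have /= /negbFE/eqP -> := constc i; have /= /negbFE/eqP -> := constc j.
apply: (@pair_weight_lt _ _ _ (Ordinal n0) (Ordinal n1)) => //.
  move=> i j neqij; apply: leq_trans (le_e i j neqij).
  by rewrite /monochromatic_exp (eqcc i j) eqxx; case: ifP.
apply: leq_trans (le_e _ _ _); last by [].
by rewrite /monochromatic_exp !ffunE /= (eqcc (Ordinal n0) (Ordinal n1)) eqxx /=; lia.
Qed.

(** * Degrees along a line *)

(* Restriction to the line spanned by (0, 1, ..., n - 1), which reads off the
   degree of a homogeneous polynomial that does not vanish on it. *)
Definition to_line (k : fieldType) (n : nat) : {mpoly k[n]} -> {poly k} :=
  mmap (@polyC k) (fun i : 'I_n => (i : nat)%:R *: 'X).

HB.instance Definition _ k n := GRing.RMorphism.on (@to_line k n).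

Lemma to_line_pair_poly (k : fieldType) (n : nat) (e : 'I_n -> 'I_n -> nat) :
  [pchar k] =i pred0 ->
  exists2 a, a != 0 & to_line (pair_poly k e) = a *: 'X^(pair_weight e).
Proof.
move=> chark.
exists (\prod_(i < n) \prod_(j < n | (i < j)%N) ((i : nat)%:R - (j : nat)%:R) ^+ e i j).
  apply/prodf_neq0 => i _; apply/prodf_neq0 => j ltij; apply: expf_neq0.
  (* Characteristic zero keeps the coordinates of the line's direction distinct. *)
  rewrite -opprB oppr_eq0 -natrB 1?ltnW //.
  by have /pcharf0P -> := chark; rewrite subn_eq0 -ltnNge.
rewrite /pair_poly /pair_weight rmorph_prod -prodrXr -scaler_prod.
apply: eq_bigr => i _; rewrite rmorph_prod -prodrXr -scaler_prod.
apply: eq_bigr => j _; rewrite rmorphXn rmorphB /= /to_line !mmapX !mmap1U.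
by rewrite -scalerBl exprZn.
Qed.

(** Every generator restricts to a scalar times a power of ['X] with exponent at least [w];
    divisibility by ['X^w] passes to combinations. *)
Lemma to_line_partite_ideal (k : fieldType) (n l w : nat) (p : {mpoly k[n]}) :
  [pchar k] =i pred0 ->
  (forall G : graph3 n, partite l.-1 G -> (w <= pair_weight (codegree G))%N) ->
  partite_ideal k n l p -> 'X^w %| to_line p.
Proof.
move=> chark wP [s [sP ->]]; rewrite rmorph_sum big_seq.
apply: (big_ind (fun q => 'X^w %| q)) => [|? ? |cg cgs]; [exact: dvdp0 | exact: dvdp_add |].
have [G [partG ->]] := sP cg cgs; rewrite rmorphM /= graph_polyE.
have [a _ ->] := to_line_pair_poly (codegree G) chark.
by rewrite -mul_polyC mulrA dvdp_mull // dvdp_exp2l // wP.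
Qed.

(** * The vacuous range [n < l] *)

Lemma complete_graph_edgesP (n : nat) (e : {set 'I_n}) :
  e \in [set f : {set 'I_n} | #|f| == 3%N] ->
  (e \subset [set: 'I_n]) /\ #|e| = 3%N.
Proof. by rewrite inE subsetT => /eqP. Qed.

(** With [n <= l - 1] every vertex can be a part of its own, and no triple is left to contribute to
    [p_G], so the generator is 1. *)
Definition complete_graph (n : nat) : graph3 n :=
  Graph3 (@complete_graph_edgesP n).

Lemma partite_complete_graph (n r : nat) :
  (n <= r)%N -> partite r (complete_graph n).
Proof.
move=> lenr; exists (fun a : 'I_r => [set i : 'I_n | i == a :> nat]); split.
- apply/setP => i; rewrite inE; apply/bigcupP; exists (widen_ord lenr i) => //.
  by rewrite inE.
- move=> a b neqab; rewrite disjoints_subset; apply/subsetP => i; rewrite !inE.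
  by move=> /eqP ->.
- move=> e a _; apply: (@leq_trans #|[set i : 'I_n | i == a :> nat]|).
    by rewrite subset_leq_card // subsetIr.
  by apply/card_le1_eqP => i j; rewrite !inE => /eqP ia /eqP ja; apply: val_inj; rewrite /= ia.
Qed.

Lemma graph_poly_complete (k : fieldType) (n : nat) :
  graph_poly k (complete_graph n) = 1.
Proof.
rewrite /graph_poly big1 // => i _; rewrite big1 // => j ltij; rewrite big1 // => h.
rewrite inE => /andP[ltjh] /negP[]; apply/eqP.
rewrite -setUA cardsU1 cards2 !inE -!val_eqE /=; lia.
Qed.

Lemma partite_ideal_full (k : fieldType) (n l : nat) (p : {mpoly k[n]}) :
  (n < l)%N -> partite_ideal k n l p.
Proof.
move=> ltnl; exists [:: (p, 1)]; split; last by rewrite big_seq1 mulr1.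
move=> cg; rewrite inE => /eqP -> /=; exists (complete_graph n); split.
  by apply: partite_complete_graph; lia.
by rewrite graph_poly_complete.
Qed.

Lemma deriv_ideal_full (k : fieldType) (n l : nat) (p : {mpoly k[n]}) :
  (n < l)%N -> deriv_ideal k n l p.
Proof.
move=> ltnl i j _ A a cardA; have := max_card (mem A); rewrite card_ord cardA; lia.
Qed.

(** * Containment and strictness *)

Lemma partite_ideal_sub_deriv_ideal (k : fieldType) (n l : nat)
    (p : {mpoly k[n]}) :
  (1 < l)%N -> partite_ideal k n l p -> deriv_ideal k n l p.
Proof.
case: l => [|[|r]] // _ [s [sP ->]]; apply: deriv_ideal_sum => cg cgs.
have [G [/partite_coloring[c cP] ->]] := sP cg cgs; rewrite graph_polyE.
exact: pair_poly_deriv_ideal (ltnSn _) (monochromatic_exp_le_codegree cP).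
Qed.

Lemma deriv_ideal_not_sub_partite_ideal (k : fieldType) (n r : nat) :
  [pchar k] =i pred0 -> (r.+2 < n)%N ->
  exists p, deriv_ideal k n r.+3 p /\ ~ partite_ideal k n r.+3 p.
Proof.
move=> chark ltrn.
pose W (c : {ffun 'I_n -> 'I_r.+2}) := pair_weight (monochromatic_exp c).
pose c := [arg min_(c < [ffun=> ord0] : {ffun 'I_n -> 'I_r.+2}) W c].
have minc c' : (W c <= W c')%N.
  by rewrite /c; case: arg_minnP => // c0 _ /(_ c' isT).
exists (pair_poly k (monochromatic_exp c)); split.
  by rewrite -[pair_poly _ _]mul1r; apply: (pair_poly_deriv_ideal (c := c)).
have wP (G : graph3 n) : partite r.+3.-1 G -> ((W c).+1 <= pair_weight (codegree G))%N.
  move=> /exists_lighter_coloring/(_ ltrn)[c' lt_c'].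
  exact: leq_ltn_trans (minc c') lt_c'.
move=> /(to_line_partite_ideal chark wP).
have [a a0 ->] := to_line_pair_poly (monochromatic_exp c) chark.
(* Membership would make ['X^(W c).+1] divide a nonzero multiple of ['X^(W c)]. *)
by rewrite dvdpZr // dvdp_Pexp2l ?size_polyX // -/(W c) ltnn.
Qed.

Local Close Scope ring_scope.

Theorem theorem1p1 (k : fieldType) (hk : [pchar k]%R =i pred0)
    (l : nat) (hl : 3 <= l) (n : nat) :
  [/\ l <= n -> strict_subset (partite_ideal k n l) (deriv_ideal k n l),
      n < l -> (forall p : {mpoly k[n]}, partite_ideal k n l p) /\
               (forall p : {mpoly k[n]}, deriv_ideal k n l p)
    & strict_subset (partite_ideal k n l) (deriv_ideal k n l) <-> l <= n].
Proof.
have strict : (l <= n)%N -> strict_subset (partite_ideal k n l) (deriv_ideal k n l).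
  case: l hl => [|[|[|r]]] // _ lern; split; last exact: deriv_ideal_not_sub_partite_ideal.
  by move=> p; apply: partite_ideal_sub_deriv_ideal.
split=> //.
- by move=> ltnl; split=> p; [exact: partite_ideal_full | exact: deriv_ideal_full].
- split=> // -[_ [p [_ notp]]]; rewrite leqNgt; apply/negP => ltnl.
  by apply: notp; apply: partite_ideal_full.
Qed.
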